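(* Let $T>0$ and let $u:\mathbb{R}^n\times(0,T]\to(0,\infty)$ be a positive bounded solution of the heat equation $\frac{\partial u}{\partial t}=\Delta u$. Let $\rho(x,t)=\frac{1}{(4\pi t)^{n/2}}\exp\left(-\frac{|x|^2}{4t}\right)$. Then for every $t\in(0,T]$ the function $$x\mapsto \log\left(\frac{u(x,t)}{\rho(x,t)}\right)$$ is convex on $\mathbb{R}^n$.
   Context: Here $\Delta$ is the Laplacian on $\mathbb{R}^n$ in the spatial variable $x$, and $\rho$ is the fundamental solution of the heat equation on $\mathbb{R}^n$. *)

(* Defs.v *)
From HB Require Import structures.
From mathcomp Require Import all_boot all_order all_algebra.
From mathcomp Require Import all_classical all_reals all_analysis.

Set Implicit Arguments.
Unset Strict Implicit.
Unset Printing Implicit Defensive.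

Import Order.TTheory GRing.Theory Num.Theory.
Import numFieldNormedType.Exports.

Local Open Scope classical_set_scope.
Local Open Scope ring_scope.

Section heat_equation.
Context {R : realType} {n : nat}.

(* The library norm on ['rV[R]_n] is the sup norm, hence this definition. *)
Definition sqr_euclid_norm (x : 'rV[R]_n) : R := \sum_(i < n) x 0 i ^+ 2.

Definition heat_kernel (x : 'rV[R]_n) (t : R) : R :=
  ((4 * pi * t) `^ (n%:R / 2))^-1 * expR (- (sqr_euclid_norm x / (4 * t))).

Definition std_basis (i : 'I_n) : 'rV[R]_n := delta_mx 0 i.

Definition laplacian (f : 'rV[R]_n -> R) (x : 'rV[R]_n) : R :=
  \sum_(i < n) 'D_(std_basis i) ('D_(std_basis i) f) x.

(* A function on R^n x (0, T] is represented by [u : 'rV[R]_n -> R -> R], whose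
   values at times outside (0, T] are irrelevant. The difference quotients in
   time only use times in (0, T]: the derivative is the usual two-sided one for
   t < T, and the left derivative for t = T. *)
Definition time_quotients (T : R) (u : 'rV[R]_n -> R -> R) (x : 'rV[R]_n)
    (t : R) :=
  (fun s => (u x s - u x t) / (s - t)) @ within `]0, T] t^'.

Definition time_derivable T u x t := cvg (time_quotients T u x t).

Definition time_derive T u x t : R := lim (time_quotients T u x t).

Definition continuous_on_strip (T : R) (f : 'rV[R]_n -> R -> R) :=
  {within [set: 'rV[R]_n] `*` `]0, T],
    continuous (fun p : 'rV[R]_n * R => f p.1 p.2)}.

(* The class C^{2,1}(R^n x (0, T]): C^2 in space and C^1 in time. *)
Record C21 (T : R) (u : 'rV[R]_n -> R -> R) : Prop := {
  C21_continuous : continuous_on_strip T u ;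
  C21_derivable1 : forall t, 0 < t <= T -> forall x i,
    derivable (u ^~ t) x (std_basis i) ;
  C21_continuous1 : forall i,
    continuous_on_strip T (fun x t => 'D_(std_basis i) (u ^~ t) x) ;
  C21_derivable2 : forall t, 0 < t <= T -> forall x i j,
    derivable ('D_(std_basis j) (u ^~ t)) x (std_basis i) ;
  C21_continuous2 : forall i j,
    continuous_on_strip T
      (fun x t => 'D_(std_basis i) ('D_(std_basis j) (u ^~ t)) x) ;
  C21_time_derivable : forall t, 0 < t <= T -> forall x,
    time_derivable T u x t ;
  C21_time_continuous : continuous_on_strip T (time_derive T u)
}.

Definition heat_solution (T : R) (u : 'rV[R]_n -> R -> R) : Prop :=
  C21 T u /\
  forall x t, 0 < t <= T -> time_derive T u x t = laplacian (u ^~ t) x.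

End heat_equation.

(* Main.v *)
(** Write q = l(1-l)/4 and z = l x + (1-l) y. Since ln rho is quadratic in x, the
    claim reads
      ln u(z,t) <= l ln u(x,t) + (1-l) ln u(y,t) + q |x-y|^2 / t,
    which follows from a maximum principle in the doubled variables (x,y),
    without a representation formula. For a positive solution U the function
    f = ln U satisfies f_t = Lap f + |grad f|^2. For two such functions f and g
    on (s,t], a minimum over all x, y and over earlier times of
      G(x,y,r) = l f(x,r) + (1-l) f(y,r) - g(z,r) + q |x-y|^2 / (r-s) + k r
    forces k <= 0: the first-order conditions in x and in y express grad f(x)
    and grad f(y) through grad g(z) and x - y, the second-order conditions in
    the simultaneous translations of x and y give the sign of the Laplacian
    terms, and the quadratic gradient terms cancel exactly against the time
    derivative of q |x-y|^2 / (r-s).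
    As f and g need not come from the same solution, take g = ln u and
    f = ln (u + d (1 + |x|^2 + 2 n r)) with d > 0: u being bounded, this
    confines the set where G <= 0 to a compact set, which stays away from r = s
    because f > g at time s. So no gradient bound on u is required. Finally
    d = s tends to 0. *)
Require Import Defs.
From HB Require Import structures.
From mathcomp Require Import all_boot all_order all_algebra.
From mathcomp Require Import all_classical all_reals all_analysis.
From mathcomp Require Import ring lra.

Set Implicit Arguments.
Unset Strict Implicit.
Unset Printing Implicit Defensive.

Import Order.TTheory GRing.Theory Num.Theory.
Import numFieldNormedType.Exports.

Local Open Scope classical_set_scope.
Local Open Scope ring_scope.

(** * Directional derivatives as derivatives along lines *)

(** Both difference quotients are the same function of the increment. Directional derivatives thus
    become one-variable ones, to which the chain rule and the tests at a minimum apply. *)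
Lemma is_derive_lineP (R : numFieldType) (V W : normedModType R) (f : V -> W)
    (x v : V) (r : R) (d : W) :
  is_derive r 1 (fun h => f (x + h *: v)) d <-> is_derive (x + r *: v) v f d.
Proof.
have E : (fun h => h^-1 *: (((fun h => f (x + h *: v)) \o shift r) (h *: 1) -
            f (x + r *: v))) =
         (fun h => h^-1 *: ((f \o shift (x + r *: v)) (h *: v) -
            f (x + r *: v))).
  apply/funext => h /=; congr (_ *: (f _ - _)).
  by rewrite [h *: 1]mulr1 scalerDl addrCA.
by split=> -[fd fE]; split; rewrite /derivable /derive ?E// -?E.
Qed.

Lemma is_derive_ln (R : realType) (V : normedModType R) (f : V -> R)
    (x v : V) (d : R) :
  0 < f x -> is_derive x v f d -> is_derive x v (fun y => ln (f y)) (d / f x).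
Proof.
move=> fx0 fd; rewrite -[x]addr0 -(scale0r v); apply/is_derive_lineP.
have /is_derive_lineP g1 : is_derive (x + 0 *: v) v f d.
  by rewrite scale0r addr0.
rewrite scale0r addr0 mulrC.
have g2 : is_derive (f (x + 0 *: v)) 1 (@ln R) (f x)^-1.
  by rewrite scale0r addr0; exact: is_derive1_ln.
exact: (is_derive1_comp g2 g1).
Qed.

Lemma is_derive_affine (R : realType) (V : normedModType R)
    (f : V -> R) (x v : V) (a r d : R) :
  is_derive (x + (a * r) *: v) v f d ->
  is_derive r 1 (fun h => f (x + (a * h) *: v)) (d * a).
Proof.
move=> fd.
have g1 : is_derive (a * r) 1 (fun h => f (x + h *: v)) d.
  exact/is_derive_lineP.
have g2 : is_derive r 1 ( *%R a : R -> R) a.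
  have := is_deriveZ a (is_derive_id r (1 : R)).
  by rewrite [a *: 1]mulr1; apply.
exact: (is_derive1_comp g1 g2).
Qed.


(** * Slopes and left derivatives *)

Lemma is_derive_slopeP (R : numFieldType) (f : R -> R) (t d : R) :
  is_derive t 1 f d <-> (fun s => (f s - f t) / (s - t)) @ t^' --> d.
Proof.
pose q h : R := h^-1 *: ((f \o shift t) (h *: 1) - f t).
have qE s : (f s - f t) / (s - t) = q (s - t).
  by rewrite /q /= [_ *: 1]mulr1 subrK mulrC.
have Eq h : q h = (f (h + t) - f t) / (h + t - t).
  by rewrite qE addrK.
split=> [[fd fE]|fd].
  have qd : q @ 0^' --> d by rewrite -fE; exact: fd.
  have st : (fun s => s - t) @ t^' --> 0^'.
    move=> A /= [e /= e0 eA]; exists e => //= s st s_neq; apply: eA => /=.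
      by rewrite sub0r normrN -opprB normrN.
    by rewrite subr_eq0.
  under eq_fun do rewrite qE.
  exact: cvg_comp st qd.
have st : (fun h => h + t) @ 0^' --> t^'.
  move=> A /= [e /= e0 eA]; exists e => //= h ht h_neq; apply: eA => /=.
    by move: ht; rewrite /= sub0r normrN opprD addrCA subrr addr0 normrN.
  by rewrite -subr_eq0 addrK.
have qd : q @ 0^' --> d.
  rewrite (_ : q = (fun s => (f s - f t) / (s - t)) \o (fun h => h + t)).
    exact: cvg_comp st fd.
  by apply/funext => h; rewrite Eq.
by split; [apply/cvg_ex; exists d | exact/cvg_lim].
Qed.

(** One-sided, because the minimum of the gap is compared with earlier times only, and because at
    the final time [T] a solution has just a left time derivative. *)
Definition left_derivative (R : numFieldType) (f : R -> R) (t d : R) :=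
  (fun s => (f s - f t) / (s - t)) @ t^'- --> d.

Lemma is_derive_left (R : numFieldType) (f : R -> R) (t d : R) :
  is_derive t 1 f d -> left_derivative f t d.
Proof. by move/is_derive_slopeP => /cvg_dnbhs_at_left. Qed.

Lemma left_derivativeD (R : numFieldType) (f g : R -> R) (t a b : R) :
  left_derivative f t a -> left_derivative g t b ->
  left_derivative (fun s => f s + g s) t (a + b).
Proof.
move=> fa gb; rewrite /left_derivative.
under eq_fun do rewrite opprD addrACA mulrDl.
exact: cvgD.
Qed.

Lemma left_derivativeZ (R : numFieldType) (k : R) (f : R -> R) (t a : R) :
  left_derivative f t a -> left_derivative (fun s => k * f s) t (k * a).
Proof.
move=> fa; rewrite /left_derivative.
under eq_fun do rewrite -mulrBr -mulrA.
exact: cvgMr.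
Qed.

(* Extending [f] affinely to the right of [t] turns the left derivative into a
   derivative, to which the chain rule applies. *)
Lemma left_derivative_ln (R : realType) (f : R -> R) (t d : R) :
  0 < f t -> left_derivative f t d ->
  left_derivative (fun s => ln (f s)) t (d / f t).
Proof.
move=> ft0 fd.
pose F s := if s <= t then f s else f t + d * (s - t).
have Ft : F t = f t by rewrite /F lexx.
have Fd : is_derive t 1 F d.
  apply/is_derive_slopeP; apply: (@cvg_at_right_left_dnbhs _ R^o).
    apply: (@cvg_trans _ (cst d @ t^'+)); last exact: cvg_cst.
    apply: near_eq_cvg; near=> s.
    have ts : t < s by near: s; exact: nbhs_right_gt.
    rewrite Ft /F leNgt ts/= addrAC subrr add0r mulfK//.
    by rewrite subr_eq0 gt_eqF.
  apply: cvg_trans fd; apply: near_eq_cvg; near=> s.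
  have st : s < t by near: s; exact: nbhs_left_lt.
  by rewrite Ft /F (ltW st).
have lnFd : is_derive t 1 (@ln R \o F) ((f t)^-1 * d).
  apply: is_derive1_comp; rewrite Ft.
  exact: is_derive1_ln.
rewrite mulrC; apply: cvg_trans (is_derive_left lnFd).
apply: near_eq_cvg; near=> s.
have st : s < t by near: s; exact: nbhs_left_lt.
by rewrite /= Ft /F (ltW st).
Unshelve. all: by end_near. Qed.

(** * Derivative tests at a minimum *)

Lemma left_derivative_at_min (R : realFieldType) (f : R -> R) (a t d : R) :
  a < t -> (forall s, a < s <= t -> f t <= f s) -> left_derivative f t d ->
  d <= 0.
Proof.
move=> at_ fmin fd; rewrite -(cvg_lim _ fd)//.
apply: limr_le; first by apply/cvg_ex; exists d.
near=> s.
have st : s < t by near: s; exact: nbhs_left_lt.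
rewrite ler_ndivrMr ?subr_lt0// mul0r subr_ge0 fmin// (ltW st) andbT.
by near: s; exact: nbhs_left_gt.
Unshelve. all: by end_near. Qed.

Lemma derive_at_min (R : realType) (k : R -> R) (r c : R) :
  (forall s : R, derivable k s 1) -> is_derive r 1 k c ->
  (forall s, k r <= k s) -> c = 0.
Proof.
move=> kd kc kmin.
have k0 : is_derive r 1 k 0.
  apply: (@derive1_at_min _ k (r - 1) (r + 1)) => //.
  - by lra.
  - by rewrite in_itv/=; apply/andP; split; lra.
by rewrite -(@derive_val _ _ _ _ _ _ _ kc) (@derive_val _ _ _ _ _ _ _ k0).
Qed.

(** Since [k1 r = 0], a negative [c] would make [k1] negative just to the right of [r], and by the
    mean value theorem [k] would drop below [k r] there. *)
Lemma second_derive_at_min (R : realType) (k k1 : R -> R) (r c : R) :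
  (forall s : R, is_derive s 1 k (k1 s)) -> is_derive r 1 k1 c ->
  (forall s, k r <= k s) -> 0 <= c.
Proof.
move=> kd k1c kmin; rewrite leNgt; apply/negP => c0.
have k10 : k1 r = 0 by apply: derive_at_min (kd r) kmin => s; exact: ex_derive.
have /is_derive_slopeP/cvgr_lt/(_ _ c0) := k1c.
case=> e /= e0 eP.
have re : r < r + e / 2 by rewrite ltrDl divr_gt0.
have kc : {within `[r, r + e / 2], continuous k}.
  apply: continuous_subspaceT => x; apply: differentiable_continuous.
  by apply/derivable1_diffP; exact: ex_derive.
have [x] := MVT re (fun x _ => kd x) kc.
rewrite in_itv/= => /andP[rx xr] kE.
have : k1 x < 0.
  have /(_ _ _)/= := eP x; rewrite k10 subr0 => H.
  have xr0 : 0 < x - r by rewrite subr_gt0.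
  rewrite -(pmulr_llt0 _ (_ : 0 < (x - r)^-1)) ?invr_gt0//.
  apply: H; last by rewrite gt_eqF.
  by rewrite distrC gtr0_norm//; lra.
have := kmin (r + e / 2); rewrite -subr_ge0 kE addrAC subrr add0r => H1 H2.
by move: H1; rewrite pmulr_lge0 ?divr_gt0// leNgt H2.
Qed.

(** * Derivatives of the squared Euclidean norm *)

Lemma is_derive_coord (R : realType) (n : nat) (x : 'rV[R]_n) (i j : 'I_n) :
  is_derive x (std_basis i) (fun y : 'rV[R]_n => y 0 j) (j == i)%:R.
Proof.
have H : (fun h : R => h^-1 *: (((fun y : 'rV[R]_n => y 0 j) \o shift x)
    (h *: std_basis i) - x 0 j)) @ 0^' --> ((j == i)%:R : R).
  apply: cvg_trans (@cvg_cst _ _ _ _ _ : cst ((j == i)%:R : R) @ 0^' --> _).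
  apply: near_eq_cvg; near=> h.
  rewrite /= !mxE addrK eqxx /= [_ *: _]mulrA mulVf ?mul1r//.
  by near: h; exact: nbhs_dnbhs_neq.
by split; [apply/cvg_ex; exists (j == i)%:R | exact/cvg_lim].
Unshelve. all: by end_near. Qed.

Lemma is_derive_sqr_euclid_norm (R : realType) (n : nat) (x : 'rV[R]_n)
    (i : 'I_n) :
  is_derive x (std_basis i) sqr_euclid_norm (2 * x 0 i).
Proof.
have -> : 2 * x 0 i = \sum_(j < n) 2 * x 0 j * (j == i)%:R.
  rewrite (bigD1 i)//= eqxx mulr1 big1 ?addr0// => j /negPf ->.
  by rewrite mulr0.
have -> : @sqr_euclid_norm R n = \sum_(j < n) (fun y : 'rV[R]_n => y 0 j ^+ 2).
  by apply/funext => y; rewrite fct_sumE.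
apply: is_derive_sum => j.
have E : (fun y : 'rV[R]_n => y 0 j) ^+ 2 = (fun y : 'rV[R]_n => y 0 j ^+ 2).
  by apply/funext=> y; rewrite exprfctE.
have := @is_deriveX _ _ _ 2 x (std_basis i) _ (is_derive_coord x i j).
by rewrite E.
Qed.

(** * The gap in doubled variables and the conditions at its minimum *)

(** The equation [f_t = Lap f + |grad f|^2] of the logarithm of a positive solution. The spatial
    derivatives [f1] and [f2] are parameters, so that explicit formulas can be supplied for them. *)
Record log_heat (R : realType) (n : nat) (s t : R) (f : 'rV[R]_n -> R -> R)
    (f1 f2 : 'I_n -> 'rV[R]_n -> R -> R) : Prop := {
  log_heat_derive1 : forall x r i, s < r <= t ->
    is_derive x (std_basis i) (f ^~ r) (f1 i x r) ;
  log_heat_derive2 : forall x r i, s < r <= t ->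
    is_derive x (std_basis i) (f1 i ^~ r) (f2 i x r) ;
  log_heat_time : forall x r, s < r <= t ->
    left_derivative (f x) r (\sum_(i < n) (f2 i x r + f1 i x r ^+ 2))
}.

Definition convexity_gap (R : realType) (n : nat) (l : R)
    (f g : 'rV[R]_n -> R -> R) (x y : 'rV[R]_n) (r : R) : R :=
  l * f x r + (1 - l) * f y r - g (l *: x + (1 - l) *: y) r.

(** The function G of the overview; a tilt [k > 0] turns a weak inequality at a minimum into a
    contradiction. *)
Definition corrected_gap (R : realType) (n : nat) (l s k : R)
    (f g : 'rV[R]_n -> R -> R) (x y : 'rV[R]_n) (r : R) : R :=
  convexity_gap l f g x y r +
  l * (1 - l) / 4 * sqr_euclid_norm (x - y) / (r - s) + k * r.

(** The points x and y move along one axis with speeds [a] and [b], so z moves with speed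
    [l * a + (1 - l) * b]. The speeds (1, 0) and (0, 1) give the first-order conditions, and (1, 1)
    gives the simultaneous translations. *)
Lemma is_derive_corrected_gap (R : realType) (n : nat) (l s t k : R)
    (f g : 'rV[R]_n -> R -> R) f1 f2 g1 g2 (x y : 'rV[R]_n) (r a b : R)
    (i : 'I_n) (h : R) :
  log_heat s t f f1 f2 -> log_heat s t g g1 g2 -> s < r <= t ->
  is_derive h 1
    (fun h => corrected_gap l s k f g (x + (a * h) *: std_basis i)
                (y + (b * h) *: std_basis i) r)
    (l * a * f1 i (x + (a * h) *: std_basis i) r +
     (1 - l) * b * f1 i (y + (b * h) *: std_basis i) r -
     (l * a + (1 - l) * b) *
       g1 i (l *: x + (1 - l) *: y +
             ((l * a + (1 - l) * b) * h) *: std_basis i) r +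
     l * (1 - l) / 2 / (r - s) *
       ((x - y + ((a - b) * h) *: std_basis i) 0 i * (a - b))).
Proof.
move=> hf hg srt; set e := std_basis i.
have zE h' : l *: (x + (a * h') *: e) + (1 - l) *: (y + (b * h') *: e) =
    l *: x + (1 - l) *: y + ((l * a + (1 - l) * b) * h') *: e.
  rewrite !scalerDr addrACA !scalerA -scalerDl. by congr (_ + _ *: _); ring.
have xyE h' : x + (a * h') *: e - (y + (b * h') *: e) =
    x - y + ((a - b) * h') *: e.
  by rewrite opprD addrACA -scalerBl mulrBl.
pose F h' := l * f (x + (a * h') *: e) r + (1 - l) * f (y + (b * h') *: e) r -
  g (l *: x + (1 - l) *: y + ((l * a + (1 - l) * b) * h') *: e) r +
  l * (1 - l) / 4 / (r - s) * sqr_euclid_norm (x - y + ((a - b) * h') *: e) +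
  k * r.
have -> : (fun h => corrected_gap l s k f g (x + (a * h) *: e)
                (y + (b * h) *: e) r) = F.
  apply/funext => h'; rewrite /corrected_gap /convexity_gap zE xyE /F.
  by rewrite [X in _ + X + k * r]mulrAC.
have dx := is_derive_affine (log_heat_derive1 hf (x + (a * h) *: e) i srt).
have dy := is_derive_affine (log_heat_derive1 hf (y + (b * h) *: e) i srt).
have dz := is_derive_affine (log_heat_derive1 hg (l *: x + (1 - l) *: y +
             ((l * a + (1 - l) * b) * h) *: e) i srt).
have dw := is_derive_affine (is_derive_sqr_euclid_norm
             (x - y + ((a - b) * h) *: e) i).
have dF := is_deriveD (is_deriveD (is_deriveB
  (is_deriveD (is_deriveZ l dx) (is_deriveZ (1 - l) dy)) dz)
  (is_deriveZ (l * (1 - l) / 4 / (r - s)) dw)) (is_derive_cst (k * r) h 1).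
apply: is_derive_eq dF _.
rewrite !/(_ *: _)/=; field.
by case/andP: srt => sr _; rewrite subr_eq0 gt_eqF.
Qed.

Lemma corrected_gap_min (R : realType) (n : nat) (l s t k : R)
    (f g : 'rV[R]_n -> R -> R) f1 f2 g1 g2 (x y : 'rV[R]_n) (r : R) :
  0 < l < 1 -> log_heat s t f f1 f2 -> log_heat s t g g1 g2 -> s < r <= t ->
  (forall x' y', corrected_gap l s k f g x y r <=
                 corrected_gap l s k f g x' y' r) ->
  (forall r', s < r' <= r -> corrected_gap l s k f g x y r <=
                             corrected_gap l s k f g x y r') ->
  k <= 0.
Proof.
move=> l01 hf hg srt xymin rmin.
set z := l *: x + (1 - l) *: y.
have l0 : l != 0 by case/andP: l01 => l0 _; rewrite gt_eqF.
have l1 : 1 - l != 0 by case/andP: l01 => _ l1; rewrite gt_eqF// subr_gt0.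
have rs0 : r - s != 0 by case/andP: (srt) => sr _; rewrite subr_eq0 gt_eqF.
have lin a : forall (v : 'rV[R]_n) i, v + (a * 0) *: std_basis i = v.
  by move=> v i; rewrite mulr0 scale0r addr0.
have grad i a b : l * a * f1 i x r + (1 - l) * b * f1 i y r -
    (l * a + (1 - l) * b) * g1 i z r +
    l * (1 - l) / 2 / (r - s) * ((x - y) 0 i * (a - b)) = 0.
  have D h := is_derive_corrected_gap l k x y a b i h hf hg srt.
  have D0 := D 0; rewrite !lin in D0.
  apply: derive_at_min (D0) _ => h; first by case: (D h).
  by rewrite !lin; exact: xymin.
(* Moving both points together leaves [x - y] fixed, so the quadratic penalty does not contribute to
   the second derivative. *)
have hess i : 0 <= l * f2 i x r + (1 - l) * f2 i y r - g2 i z r.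
  have D h := is_derive_corrected_gap l k x y 1 1 i h hf hg srt.
  apply: (second_derive_at_min (r := 0) D); last first.
    by move=> h; rewrite !lin; exact: xymin.
  have -> : l * 1 + (1 - l) * 1 = 1 by ring.
  have dx := is_derive_affine (a := 1) (r := 0) (x := x)
    (log_heat_derive2 hf _ i srt).
  have dy := is_derive_affine (a := 1) (r := 0) (x := y)
    (log_heat_derive2 hf _ i srt).
  have dz := is_derive_affine (a := 1) (r := 0) (x := z)
    (log_heat_derive2 hg _ i srt).
  rewrite lin in dx; rewrite lin in dy; rewrite lin in dz.
  have dF := is_deriveB
    (is_deriveD (is_deriveZ l dx) (is_deriveZ (1 - l) dy)) dz.
  rewrite !mulr1 in dF.
  set k1 := (X in is_derive _ _ X _) in dF.
  rewrite [X in is_derive _ _ X _](_ : _ = k1)//.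
  by apply/funext => h; rewrite subrr !mulr0 addr0 !mulr1 [1 * g1 _ _ _]mul1r.
(* The left time derivative of the gap at the minimum, with the time derivatives of [f] and [g]
   replaced through their equation. *)
have tm : l * \sum_(i < n) (f2 i x r + f1 i x r ^+ 2) +
    (1 - l) * \sum_(i < n) (f2 i y r + f1 i y r ^+ 2) -
    \sum_(i < n) (g2 i z r + g1 i z r ^+ 2) -
    l * (1 - l) / 4 * sqr_euclid_norm (x - y) / (r - s) ^+ 2 + k <= 0.
  case/andP: (srt) => sr rt.
  have rs1 : left_derivative (fun r' => (r' - s)^-1) r (- (r - s) ^- 2).
    apply: is_derive_left.
    have sd : is_derive r 1 (fun r' => r' - s) 1 by exact: is_derive_shift.
    have := @is_deriveV R (fun r' => r' - s) r _ _ rs0 sd.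
    by rewrite [_ *: 1]mulr1.
  have kd : left_derivative ( *%R k) r (k * 1).
    by apply: left_derivativeZ; exact: is_derive_left.
  have gd := left_derivativeZ (k := (-1)) (log_heat_time (x := z) hg srt).
  have D := left_derivativeD (left_derivativeD (left_derivativeD
    (left_derivativeD
       (left_derivativeZ (k := l) (log_heat_time (x := x) hf srt))
       (left_derivativeZ (k := (1 - l)) (log_heat_time (x := y) hf srt))) gd)
    (left_derivativeZ (k := l * (1 - l) / 4 * sqr_euclid_norm (x - y)) rs1)) kd.
  apply: (left_derivative_at_min sr rmin).
  rewrite /corrected_gap /convexity_gap.
  under eq_fun do rewrite -[X in _ + _ - X]mul1r -mulNr.
  move: D; rewrite mulr1 mulN1r mulrN.
  exact.
(* With [w = (x - y)_i / (2 (r - s))], the first-order conditions give [f1(x) = g1(z) - (1 - l) w]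
   and [f1(y) = g1(z) + l w]. Hence [l f1(x)^2 + (1 - l) f1(y)^2 - g1(z)^2 = l (1 - l) w^2], which
   is what the penalty subtracts. *)
have {}tm :
    \sum_(i < n) (l * f2 i x r + (1 - l) * f2 i y r - g2 i z r) + k <= 0.
  apply: le_trans tm; rewrite le_eqVlt; apply/orP; left; apply/eqP.
  congr (_ + k); rewrite /sqr_euclid_norm !mulr_sumr mulr_suml.
  rewrite -big_split/= -!sumrB; apply: eq_bigr => i _.
  have fx : f1 i x r = g1 i z r - (1 - l) / 2 / (r - s) * (x - y) 0 i.
    apply: (mulfI l0); have G := grad i 1 0.
    by apply: subr0_eq; rewrite -[RHS]G; field.
  have fy : f1 i y r = g1 i z r + l / 2 / (r - s) * (x - y) 0 i.
    apply: (mulfI l1); have G := grad i 0 1.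
    by apply: subr0_eq; rewrite -[RHS]G; field.
  by rewrite fx fy; field.
have : 0 <= \sum_(i < n) (l * f2 i x r + (1 - l) * f2 i y r - g2 i z r).
  by apply: sumr_ge0 => i _; exact: hess.
by move: tm; lra.
Qed.

(** * Compactness and the minimum principle *)

Lemma closed_le0 (R : realType) (T : topologicalType) (f : T -> R) :
  continuous f -> closed [set x | f x <= 0].
Proof.
by move=> cf; apply: preimage_closed (@closed_le R 0) => x _; exact: cf.
Qed.

Lemma compact_norm_le (R : realType) (n : nat) (b : R) :
  compact [set x : 'rV[R]_n | `|x| <= b].
Proof.
apply: bounded_closed_compact.
  exists b; split; first exact: num_real.
  by move=> M bM x /= /le_trans; apply; exact: ltW.
apply: preimage_closed (@closed_le R b) => x _; exact: norm_continuous.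
Qed.

Lemma continuous_sqr_euclid_norm (R : realType) (n : nat) :
  continuous (@sqr_euclid_norm R n).
Proof.
move=> x; apply: (@cvg_big _ _ _ _ _ _ _ (nbhs x)) => [|i _].
  exact: add_continuous.
rewrite expr2; under eq_fun do rewrite expr2.
by apply: cvgM; exact: coord_continuous.
Qed.

Lemma sqr_euclid_norm_ge0 (R : realType) (n : nat) (x : 'rV[R]_n) :
  0 <= sqr_euclid_norm x.
Proof. by apply: sumr_ge0 => i _; exact: sqr_ge0. Qed.

Lemma sqr_euclid_norm_eq0 (R : realType) (n : nat) (x : 'rV[R]_n) :
  (sqr_euclid_norm x == 0) = (x == 0).
Proof.
rewrite psumr_eq0; last by move=> i _; exact: sqr_ge0.
apply/allP/eqP => [x0|-> i _]; last by rewrite /= mxE expr0n /= eqxx.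
apply/rowP => i; rewrite mxE; apply/eqP.
by rewrite -sqrf_eq0; exact: x0 (mem_index_enum i).
Qed.

Lemma convexity_gap_continuous (R : realType) (n : nat) (l : R)
    (f g : 'rV[R]_n -> R -> R) :
  continuous (fun p : 'rV[R]_n * R => f p.1 p.2) ->
  continuous (fun p : 'rV[R]_n * R => g p.1 p.2) ->
  continuous (fun p : 'rV[R]_n * 'rV[R]_n * R =>
    convexity_gap l f g p.1.1 p.1.2 p.2).
Proof.
move=> cf cg [[x y] r].
have cx : p.1.1 @[p --> (x, y, r)] --> x.
  exact: cvg_comp cvg_fst cvg_fst.
have cy : p.1.2 @[p --> (x, y, r)] --> y.
  exact: cvg_comp cvg_fst cvg_snd.
have cr : p.2 @[p --> (x, y, r)] --> r by exact: cvg_snd.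
have cz : (l *: p.1.1 + (1 - l) *: p.1.2) @[p --> (x, y, r)] -->
    l *: x + (1 - l) *: y.
  by apply: cvgD; apply: cvgZr.
apply: cvgB; first apply: cvgD.
- by apply: cvgMr; exact: (continuous2_cvg _ (h := f) (cf (x, r)) cx cr).
- by apply: cvgMr; exact: (continuous2_cvg _ (h := f) (cf (y, r)) cy cr).
- exact: (continuous2_cvg _ (h := g) (cg (_, r)) cz cr).
Qed.

(** A negative value would survive a small tilt [k > 0]; the tilted gap would then attain a negative
    global minimum, against [corrected_gap_min]. *)
Lemma corrected_gap_ge0 (R : realType) (n : nat) (l s t b : R)
    (f g : 'rV[R]_n -> R -> R) f1 f2 g1 g2 :
  0 < l < 1 -> 0 <= s -> log_heat s t f f1 f2 -> log_heat s t g g1 g2 ->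
  continuous (fun p : 'rV[R]_n * R => f p.1 p.2) ->
  continuous (fun p : 'rV[R]_n * R => g p.1 p.2) ->
  (forall x, g x s < f x s) ->
  (forall x y r, s <= r <= t -> convexity_gap l f g x y r <= 0 ->
    `|x| <= b /\ `|y| <= b) ->
  forall x y r, s < r <= t -> 0 <= corrected_gap l s 0 f g x y r.
Proof.
move=> l01 s0 hf hg cf cg gf coercive x0 y0 r0 sr0.
rewrite leNgt; apply/negP => gap0.
set q := l * (1 - l) / 4.
have q0 : 0 < q.
  by case/andP: l01 => l0 l1; rewrite divr_gt0 ?mulr_gt0 ?subr_gt0.
have r0_gt0 : 0 < r0 by case/andP: sr0 => sr0 _; exact: le_lt_trans sr0.
have gapE k x y r : corrected_gap l s k f g x y r =
    corrected_gap l s 0 f g x y r + k * r.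
  by rewrite /corrected_gap mul0r addr0.
have gap0E x y r : corrected_gap l s 0 f g x y r =
    convexity_gap l f g x y r + q * sqr_euclid_norm (x - y) / (r - s).
  by rewrite /corrected_gap mul0r addr0.
(* Chosen so that the tilt cancels exactly half of the negative value at [(x0, y0, r0)]. *)
pose k := - corrected_gap l s 0 f g x0 y0 r0 / (2 * r0).
have k0 : 0 < k by rewrite divr_gt0 ?mulr_gt0 ?oppr_gt0.
have kgap0 : corrected_gap l s k f g x0 y0 r0 < 0.
  rewrite gapE (_ : k * r0 = - corrected_gap l s 0 f g x0 y0 r0 / 2); first lra.
  by rewrite /k; field; rewrite gt_eqF.
pose D (p : 'rV[R]_n * 'rV[R]_n * R) := convexity_gap l f g p.1.1 p.1.2 p.2.
pose N (p : 'rV[R]_n * 'rV[R]_n * R) := q * sqr_euclid_norm (p.1.1 - p.1.2).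
(* For [r > s] this is [r - s] times the untilted gap, so it has the same sign; unlike the gap it is
   continuous up to [r = s], which makes [K] closed. *)
pose P p := (p.2 - s) * D p + N p.
have cD : continuous D by exact: convexity_gap_continuous.
have cr (p : 'rV[R]_n * 'rV[R]_n * R) : r.2 - s @[r --> p] --> p.2 - s.
  by apply: cvgB; [exact: cvg_snd | exact: cvg_cst].
have cN : continuous N.
  move=> p; apply: cvgMr.
  apply: (@continuous_comp _ _ _
    (fun p : 'rV[R]_n * 'rV[R]_n * R => p.1.1 - p.1.2)
    (@sqr_euclid_norm R n)); last exact: continuous_sqr_euclid_norm.
  apply: cvgB; first exact: cvg_comp cvg_fst cvg_fst.
  exact: cvg_comp cvg_fst cvg_snd.
have cP : continuous P.
  move=> p; apply: cvgD; last exact: cN.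
  by apply: cvgM; [exact: cr | exact: cD].
pose K := ([set x | `|x| <= b] `*` [set y | `|y| <= b]) `*` `[s, t] `&`
  ([set p | D p <= 0] `&` [set p | P p <= 0]).
have compactK : compact K.
  apply: compact_closedI.
    apply: compact_setX; last exact: segment_compact.
    by apply: compact_setX; exact: compact_norm_le.
  by apply: closedI; exact: closed_le0.
(* At [r = s] the condition [P p <= 0] forces [x = y], and then [D p] is [f - g] at time [s], which
   is positive. *)
have Ks p : K p -> s < p.2 <= t.
  move=> [[_ /=]]; rewrite in_itv/= => /andP[sp ->] [Dp Pp].
  rewrite andbT lt_neqAle sp andbT; apply/eqP => spE.
  move: Pp; rewrite /= /P -spE subrr mul0r add0r /N pmulr_rle0// => N0.
  have /eqP : sqr_euclid_norm (p.1.1 - p.1.2) = 0.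
    by apply/le_anti; rewrite N0 sqr_euclid_norm_ge0.
  rewrite sqr_euclid_norm_eq0 subr_eq0 => /eqP xy.
  move: Dp; rewrite /= /D /convexity_gap xy -spE -mulrDl -scalerDl subrKC.
  by rewrite scale1r mul1r subr_le0 leNgt gf.
pose F p := corrected_gap l s k f g p.1.1 p.1.2 p.2.
have cF : {within K, continuous F}.
  apply: continuous_in_subspaceT => p; rewrite inE => /Ks /andP[sp _].
  apply: cvgD; first apply: cvgD.
  - exact: cD.
  - apply: cvgM; first exact: cN.
    by apply: cvgV; [rewrite subr_eq0 gt_eqF | exact: cr].
  - by apply: cvgMr; exact: cvg_snd.
(* Outside [K] even the untilted gap is positive, so a negative minimum over [K] is a minimum over
   all points with time in [(s, t]]. *)
have outK x y r : s < r <= t -> ~ K (x, y, r) ->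
    0 < corrected_gap l s k f g x y r.
  move=> srt nK; have sr : 0 < r - s by case/andP: srt; rewrite subr_gt0.
  have srt' : s <= r <= t by case/andP: srt => /ltW -> ->.
  have kr : 0 <= k * r.
    by rewrite mulr_ge0 ?(ltW k0)// (le_trans s0)//; case/andP: srt'.
  rewrite gapE ltr_pwDl// gap0E ltNge; apply/negP => gap_le0.
  have N0 : 0 <= N (x, y, r) by rewrite mulr_ge0 ?sqr_euclid_norm_ge0// ltW.
  have D0 : D (x, y, r) <= 0.
    by apply: le_trans gap_le0; rewrite lerDl divr_ge0// ltW.
  apply: nK; split; last split => //=.
    by have [] := coercive x y r srt' D0; split => //=; rewrite in_itv.
  rewrite /P /= -(pmulr_rle0 _ (_ : 0 < (r - s)^-1)) ?invr_gt0//.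
  rewrite mulrDr mulKf ?gt_eqF//.
  by rewrite [_^-1 * _]mulrC.
have K0 : K (x0, y0, r0).
  by apply: contrapT => /(outK _ _ _ sr0); rewrite ltNge (ltW kgap0).
have [[[x y] r]] := compact_EVT_min (ex_intro _ _ K0) compactK cF.
rewrite inE => Kxyr Fmin.
have srt := Ks _ Kxyr.
have Fxyr : F (x, y, r) < 0.
  by apply: le_lt_trans kgap0; apply: (Fmin (x0, y0, r0)); rewrite inE.
have gmin x' y' r' : s < r' <= t ->
    corrected_gap l s k f g x y r <= corrected_gap l s k f g x' y' r'.
  move=> srt'; have [K'|/(outK _ _ _ srt')] := pselect (K (x', y', r')).
    by apply: (Fmin (x', y', r')); rewrite inE.
  by move=> F'; apply: ltW; exact: lt_trans F'.
suff : k <= 0 by rewrite leNgt k0.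
apply: (corrected_gap_min l01 hf hg srt).
- by move=> x' y'; exact: gmin.
- move=> r' /andP[sr' r'r]; apply: gmin; rewrite sr'/=.
  by case/andP: srt => _; exact: le_trans.
Qed.

(** * Logarithms of lifted solutions *)

(** Freezing time outside [[s, t]] yields functions continuous on the whole space, as
    [corrected_gap_ge0] requires, without changing them on [[s, t]]. *)
Definition clamp (R : realType) (s t r : R) : R := Num.max s (Num.min r t).

Lemma clamp_id (R : realType) (s t r : R) : s <= r <= t -> clamp s t r = r.
Proof. by case/andP=> sr rt; rewrite /clamp min_l// max_r. Qed.

Lemma clamp_itv (R : realType) (s t r : R) : s <= t -> s <= clamp s t r <= t.
Proof.
by move=> st; rewrite /clamp le_max lexx/= ge_max st/= ge_min lexx orbT.
Qed.

Lemma continuous_clamp (R : realType) (s t : R) : continuous (clamp s t).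
Proof.
move=> r; apply: (@continuous_max R R (cst s) (Num.min^~ t)).
  exact: cvg_cst.
apply: (@continuous_min R R id (cst t)); [exact: cvg_id | exact: cvg_cst].
Qed.

(** The sup norm is attained at some coordinate, and [a <= 1 + a^2]. This links the norm used for
    compactness to the Euclidean one. *)
Lemma norm_le_sqr_euclid_norm (R : realType) (n : nat) (x : 'rV[R]_n) :
  `|x| <= 1 + sqr_euclid_norm x.
Proof.
have [x0|x0] := eqVneq `|x| 0.
  by rewrite x0 addr_ge0// sqr_euclid_norm_ge0.
have [[i j] /= xE] := mx_norm_neq0 x0.
rewrite -[`|x|]/(mx_norm x) xE (ord1 i).
have xj : x 0 j ^+ 2 <= sqr_euclid_norm x.
  rewrite /sqr_euclid_norm (bigD1 j)//= lerDl.
  by apply: sumr_ge0 => k _; exact: sqr_ge0.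
apply: (@le_trans _ _ (1 + `|x 0 j| ^+ 2)); last first.
  by rewrite real_normK ?num_real// lerD2l.
by have := normr_ge0 (x 0 j); nra.
Qed.

(* [1 + |x|^2 + 2 n r] is a positive solution of the heat equation which is
   proper in [x]. *)
Definition lift_solution (R : realType) (n : nat) (d : R)
    (u : 'rV[R]_n -> R -> R) (x : 'rV[R]_n) (r : R) : R :=
  u x r + d * (1 + sqr_euclid_norm x + 2 * n%:R * r).

Section log_heat_solution.
Context (R : realType) (n : nat) (T d : R) (u : 'rV[R]_n -> R -> R).
Hypothesis u_gt0 : forall x t, 0 < t <= T -> 0 < u x t.
Hypothesis u_heat : heat_solution T u.
Hypothesis d_ge0 : 0 <= d.

Let C21u : C21 T u := u_heat.1.

Lemma lift_solution_gt0 x r : 0 < r <= T -> 0 < lift_solution d u x r.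
Proof.
move=> rT; rewrite ltr_pwDl ?u_gt0// mulr_ge0//.
rewrite !addr_ge0 ?sqr_euclid_norm_ge0//.
by case/andP: rT => r0 _; rewrite !mulr_ge0// ltW.
Qed.

Lemma is_derive_lift_solution x r i : 0 < r <= T ->
  is_derive x (std_basis i) (lift_solution d u ^~ r)
    ('D_(std_basis i) (u ^~ r) x + d * (2 * x 0 i)).
Proof.
move=> rT.
have /derivableP du : derivable (u ^~ r) x (std_basis i).
  exact: (C21_derivable1 C21u).
have dw := is_deriveZ d (is_deriveD (is_deriveD
  (is_derive_cst (1 : R) x (std_basis i)) (is_derive_sqr_euclid_norm x i))
  (is_derive_cst (2 * n%:R * r) x (std_basis i))).
rewrite add0r addr0 in dw.
exact: (is_deriveD du dw).
Qed.

Lemma is_derive2_lift_solution x r i : 0 < r <= T ->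
  is_derive x (std_basis i)
    (fun y => 'D_(std_basis i) (u ^~ r) y + d * (2 * y 0 i))
    ('D_(std_basis i) ('D_(std_basis i) (u ^~ r)) x + d * 2).
Proof.
move=> rT.
have /derivableP du :
    derivable ('D_(std_basis i) (u ^~ r)) x (std_basis i).
  exact: (C21_derivable2 C21u).
have dw := is_deriveZ d (is_deriveZ 2 (is_derive_coord x i i)).
rewrite eqxx [2 *: _]mulr1 in dw.
exact: (is_deriveD du dw).
Qed.

Lemma left_derivative_lift_solution x r : 0 < r <= T ->
  left_derivative (lift_solution d u x) r
    (\sum_(i < n) ('D_(std_basis i) ('D_(std_basis i) (u ^~ r)) x + d * 2)).
Proof.
move=> rT; case/andP: (rT) => r0 rT'.
(* The Laplacian of [d |x|^2] is [2 n d], the time derivative of [2 n d r]. *)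
have -> :
    \sum_(i < n) ('D_(std_basis i) ('D_(std_basis i) (u ^~ r)) x + d * 2) =
    laplacian (u ^~ r) x + d * (2 * n%:R).
  rewrite /laplacian big_split/=; congr (_ + _).
  by rewrite sumr_const card_ord -[LHS]mulr_natr mulrA.
apply: left_derivativeD.
  rewrite -(u_heat.2 x r rT).
  have cv : time_derivable T u x r by exact: (C21_time_derivable C21u).
  (* All times close to [r] on its left lie in []0, T]], so the limit of [time_quotients] is also
     the limit from the left. *)
  apply: cvg_trans cv; apply: cvg_app => A.
  move=> nA.
  have {}nA : \forall s \near r, s != r -> `]0, T]%classic s -> A s.
    exact: nA.
  change (\forall s \near r, s < r -> A s).
  have r_gt0 := lt_nbhsr r0.
  near=> s => sr.
  have s0 : 0 < s by near: s.
  have : s != r -> `]0, T]%classic s -> A s by near: s.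
  by apply; [rewrite lt_eqF | rewrite /= in_itv/= s0 (le_trans (ltW sr))].
apply: left_derivativeZ; apply: is_derive_left.
have D := is_deriveD (is_derive_cst (1 + sqr_euclid_norm x) r 1)
  (is_deriveZ (2 * n%:R) (is_derive_id r (1 : R))).
by rewrite add0r [_ *: 1]mulr1 in D.
Unshelve. all: by end_near. Qed.

Lemma log_heat_lift_solution s t : 0 < s -> t <= T ->
  log_heat s t (fun x r => ln (lift_solution d u x (clamp s t r)))
    (fun i x r => ('D_(std_basis i) (u ^~ r) x + d * (2 * x 0 i)) /
       lift_solution d u x r)
    (fun i x r => ('D_(std_basis i) ('D_(std_basis i) (u ^~ r)) x + d * 2) /
       lift_solution d u x r -
       (('D_(std_basis i) (u ^~ r) x + d * (2 * x 0 i)) /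
       lift_solution d u x r) ^+ 2).
Proof.
move=> s0 tT.
have sT r : s < r <= t -> 0 < r <= T.
  by case/andP=> sr rt; rewrite (lt_trans s0 sr) (le_trans rt tT).
split=> x r => [i srt|i srt|srt]; have rT := sT _ srt;
  have U0 := lift_solution_gt0 x rT;
  have cr : clamp s t r = r by
    apply: clamp_id; case/andP: srt => /ltW -> ->.
- rewrite cr; apply: (is_derive_ln (f := lift_solution d u ^~ r)) => //.
  exact: is_derive_lift_solution.
- have U'0 : lift_solution d u x r != 0 by rewrite gt_eqF.
  have [Ud UE] := is_derive_lift_solution x i rT.
  have dV : is_derive x (std_basis i) (fun y => (lift_solution d u y r)^-1)
      (- lift_solution d u x r ^- 2 *:
        ('D_(std_basis i) (u ^~ r) x + d * (2 * x 0 i))).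
    by split; [exact: derivableV | rewrite deriveV// UE].
  apply: is_derive_eq (is_deriveM (is_derive2_lift_solution x i rT) dV) _.
  by rewrite !/(_ *: _)/=; field.
(* In [f2 + f1^2] the squares cancel; what remains is the Laplacian of the lift over the lift, that
   is, its logarithmic time derivative. *)
- rewrite (eq_bigr (fun i =>
      ('D_(std_basis i) ('D_(std_basis i) (u ^~ r)) x + d * 2) /
       lift_solution d u x r)); last by move=> i _; rewrite subrK.
  rewrite -mulr_suml.
  have [sr rt] := andP srt.
  have := left_derivative_ln U0 (left_derivative_lift_solution (x := x) rT).
  apply: cvg_trans; apply: near_eq_cvg; near=> s'.
  have sr' : s < s' by near: s'; exact: nbhs_left_gt.
  have s'r : s' < r by near: s'; exact: nbhs_left_lt.
  by rewrite cr clamp_id// (ltW sr') (le_trans (ltW s'r)).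
Unshelve. all: by end_near. Qed.

Lemma continuous_ln_lift_solution s t : 0 < s <= t -> t <= T ->
  continuous (fun p : 'rV[R]_n * R =>
    ln (lift_solution d u p.1 (clamp s t p.2))).
Proof.
move=> /andP[s0 st] tT p.
have cT : 0 < clamp s t p.2 <= T.
  have /andP[sc ct] := clamp_itv p.2 st.
  by rewrite (lt_le_trans s0 sc) (le_trans ct).
have cc : clamp s t q.2 @[q --> p] --> clamp s t p.2.
  by apply: cvg_comp; [exact: cvg_snd | exact: continuous_clamp].
apply: (cvg_comp (fun q => lift_solution d u q.1 (clamp s t q.2)) (@ln R));
  last exact: continuous_ln (lift_solution_gt0 _ cT).
apply: cvgD; last first.
  apply: cvgMr; apply: cvgD; last exact: cvgMr.
  apply: cvgD; first exact: cvg_cst.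
  apply: (cvg_comp fst (@sqr_euclid_norm R n)); first exact: cvg_fst.
  exact: continuous_sqr_euclid_norm.
(* Continuity of [u] is known only relative to the strip, but the pair with clamped time always lies
   in the strip. *)
have /subspace_continuousP cu := C21_continuous C21u.
apply: (cvg_comp (fun q : 'rV[R]_n * R => (q.1, clamp s t q.2))
  (fun q : 'rV[R]_n * R => u q.1 q.2)); last first.
  by apply: (cu (p.1, clamp s t p.2)); split => //=; rewrite in_itv.
have ccp : (q.1, clamp s t q.2) @[q --> p] --> (p.1, clamp s t p.2).
  exact: (cvg_pair cvg_fst cc).
move=> A /ccp nA; change (\forall q \near p, A (q.1, clamp s t q.2)).
apply: (filterS (F := nbhs p)) nA => q /=; apply; split => //=.
rewrite in_itv/=; have /andP[sc cle] := clamp_itv q.2 st.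
by rewrite (lt_le_trans s0 sc) (le_trans cle tT).
Qed.

End log_heat_solution.

(** * Coercivity and the limit [d -> 0] *)

(** The logarithm at y is at least [ln d], so the bound [c] on the combination bounds the logarithm
    at x; and the lift at x is at least [d (1 + |x|^2)], hence at least [d] times the sup norm. *)
Lemma lift_solution_norm_le (R : realType) (n : nat) (d c a r : R)
    (u : 'rV[R]_n -> R -> R) (x y : 'rV[R]_n) :
  0 < d -> 0 < a < 1 -> 0 < r -> 0 <= u x r -> 0 <= u y r ->
  a * ln (lift_solution d u x r) + (1 - a) * ln (lift_solution d u y r) <= c ->
  `|x| <= expR ((c - (1 - a) * ln d) / a) / d.
Proof.
move=> d0 /andP[a0 a1] r0 ux uy ac.
have lift_ge z : 0 <= u z r ->
    d * (1 + sqr_euclid_norm z) <= lift_solution d u z r.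
  move=> uz; rewrite -[leLHS]add0r lerD// ler_pM2l// lerDl.
  by rewrite !mulr_ge0// ltW.
have d_le (z : 'rV[R]_n) : d <= d * (1 + sqr_euclid_norm z).
  by rewrite ler_pMr// lerDl sqr_euclid_norm_ge0.
have lift0 z : 0 <= u z r -> 0 < lift_solution d u z r.
  by move=> /lift_ge/(lt_le_trans (lt_le_trans d0 (d_le z))).
have lny : ln d <= ln (lift_solution d u y r).
  by rewrite ler_ln ?posrE ?lift0// (le_trans (d_le y))// lift_ge.
rewrite ler_pdivlMr// mulrC.
apply: (@le_trans _ _ (lift_solution d u x r)).
  by apply: le_trans (lift_ge x ux); rewrite ler_pM2l// norm_le_sqr_euclid_norm.
rewrite -[leLHS]lnK ?posrE ?lift0// ler_expR ler_pdivlMr// mulrC.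
have : (1 - a) * ln d <= (1 - a) * ln (lift_solution d u y r).
  by rewrite ler_wpM2l// subr_ge0 ltW.
by lra.
Qed.

Lemma ln_solution_le_lift (R : realType) (n : nat) (T M d l t : R)
    (u : 'rV[R]_n -> R -> R) (x y : 'rV[R]_n) :
  (forall x t, 0 < t <= T -> 0 < u x t) ->
  (forall x t, 0 < t <= T -> u x t <= M) ->
  heat_solution T u -> 0 < l < 1 -> 0 < d < t -> t <= T ->
  ln (u (l *: x + (1 - l) *: y) t) <=
  l * ln (lift_solution d u x t) + (1 - l) * ln (lift_solution d u y t) +
  l * (1 - l) / 4 * sqr_euclid_norm (x - y) / (t - d).
Proof.
move=> u_gt0 u_le u_heat l01 /andP[d0 dt] tT.
have ddt : 0 < d <= t by rewrite d0 ltW.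
have rT r : d <= r <= t -> 0 < r <= T.
  by case/andP=> dr rt; rewrite (lt_le_trans d0 dr) (le_trans rt).
have lift0 z r : lift_solution 0 u z r = u z r.
  by rewrite /lift_solution mul0r addr0.
have [l0 l1] := andP l01.
have l01' : 0 < 1 - l < 1 by rewrite subr_gt0 l1 gtrBl.
(* The radii from [lift_solution_norm_le] with [c = ln M]: weight [l] confines x, and weight
   [1 - l], with the roles exchanged, confines y. *)
pose b := Num.max (expR ((ln M - (1 - l) * ln d) / l) / d)
  (expR ((ln M - (1 - (1 - l)) * ln d) / (1 - l)) / d).
(* The parameter [d] serves both as size of the lift and as initial time; [g] is the lift with
   parameter 0, that is, [ln u]. *)
have := @corrected_gap_ge0 R n l d t b _ _ _ _ _ _ l01 (ltW d0)
  (log_heat_lift_solution u_gt0 u_heat (ltW d0) d0 tT)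
  (log_heat_lift_solution u_gt0 u_heat (lexx 0) d0 tT)
  (continuous_ln_lift_solution u_gt0 u_heat (ltW d0) ddt tT)
  (continuous_ln_lift_solution u_gt0 u_heat (lexx 0) ddt tT).
have dd : clamp d t d = d by apply: clamp_id; rewrite lexx ltW.
have tt : clamp d t t = t by apply: clamp_id; rewrite lexx ltW.
move=> /(_ _ _ x y t); rewrite dt lexx => H.
have {}H : 0 <= corrected_gap l d 0
    (fun x r => ln (lift_solution d u x (clamp d t r)))
    (fun x r => ln (lift_solution 0 u x (clamp d t r))) x y t.
  apply: H => //.
    move=> z; have dT : 0 < d <= T by apply: rT; rewrite lexx ltW.
    have Ud := lift_solution_gt0 u_gt0 (ltW d0) z dT.
    rewrite dd ltr_ln ?posrE// lift0 ?u_gt0//.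
    rewrite ltrDl mulr_gt0// -addrA ltr_pwDl//.
    by rewrite addr_ge0 ?sqr_euclid_norm_ge0// !mulr_ge0// ltW.
  move=> x' y' r drt; have rT' := rT _ drt; have [r0 _] := andP rT'.
  rewrite /convexity_gap clamp_id// lift0 subr_le0 => gap_le.
  have uM : ln (u (l *: x' + (1 - l) *: y') r) <= ln M.
    have M0 : 0 < M by rewrite (lt_le_trans (u_gt0 x' r rT'))// u_le.
    by rewrite ler_ln ?posrE ?u_gt0 ?u_le.
  have {}gap_le := le_trans gap_le uM.
  have ux := ltW (u_gt0 x' r rT'); have uy := ltW (u_gt0 y' r rT').
  rewrite !le_max; split; apply/orP; [left|right].
    exact: lift_solution_norm_le d0 l01 r0 ux uy gap_le.
  apply: (lift_solution_norm_le d0 l01' r0 uy ux).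
  by rewrite subKr addrC.
move: H; rewrite /corrected_gap /convexity_gap tt lift0.
by lra.
Qed.

Lemma ln_solution_le (R : realType) (n : nat) (T M l t : R)
    (u : 'rV[R]_n -> R -> R) (x y : 'rV[R]_n) :
  (forall x t, 0 < t <= T -> 0 < u x t) ->
  (forall x t, 0 < t <= T -> u x t <= M) ->
  heat_solution T u -> 0 < l < 1 -> 0 < t <= T ->
  ln (u (l *: x + (1 - l) *: y) t) <=
  l * ln (u x t) + (1 - l) * ln (u y t) +
  l * (1 - l) / 4 * sqr_euclid_norm (x - y) / t.
Proof.
move=> u_gt0 u_le u_heat l01 tT; have [t0 _] := andP tT.
(* The upper bound of [ln_solution_le_lift] as a function of [d]: it is continuous at 0, where its
   value is the desired bound. *)
pose h d := l * ln (lift_solution d u x t) +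
  (1 - l) * ln (lift_solution d u y t) +
  l * (1 - l) / 4 * sqr_euclid_norm (x - y) / (t - d).
have lift0 z : lift_solution 0 u z t = u z t.
  by rewrite /lift_solution mul0r addr0.
have clift z : ln (lift_solution d u z t) @[d --> 0] --> ln (u z t).
  rewrite -(lift0 z).
  apply: (cvg_comp (fun d => lift_solution d u z t) (@ln R)).
    by apply: cvgD; [exact: cvg_cst | apply: cvgMl; exact: cvg_id].
  by apply: continuous_ln; rewrite lift0 u_gt0.
have h0 : h d @[d --> 0] --> h 0.
  rewrite /h !lift0; apply: cvgD.
    by apply: cvgD; apply: cvgMr; exact: clift.
  apply: cvgMr; apply: cvgV; first by rewrite subr0 gt_eqF.
  by apply: cvgB; [exact: cvg_cst | exact: cvg_id].
have -> : l * ln (u x t) + (1 - l) * ln (u y t) +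
    l * (1 - l) / 4 * sqr_euclid_norm (x - y) / t = h 0.
  by rewrite /h !lift0 subr0.
have h0r : h d @[d --> 0^'+] --> h 0 by exact: cvg_at_right_filter.
rewrite -(cvg_lim _ h0r)//; apply: limr_ge; first by apply/cvg_ex; exists (h 0).
near=> d; apply: (ln_solution_le_lift _ _ u_gt0 u_le u_heat l01).
- by apply/andP; split; near: d; [exact: nbhs_right_gt | exact: nbhs_right_lt].
- by case/andP: tT.
Unshelve. all: by end_near. Qed.

(** * The heat kernel and the convexity of the quotient *)

Lemma ln_heat_kernel (R : realType) (n : nat) (x : 'rV[R]_n) (t : R) :
  0 < t -> ln (heat_kernel x t) =
    - ln ((4 * pi * t) `^ (n%:R / 2)) - sqr_euclid_norm x / (4 * t).
Proof.
move=> t0.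
have c0 : 0 < (4 * pi * t) `^ (n%:R / 2) :> R.
  by rewrite powR_gt0// !mulr_gt0// pi_gt0.
by rewrite /heat_kernel lnM ?posrE ?invr_gt0 ?expR_gt0// lnV ?posrE// expRK.
Qed.

(** Divided by [4 t], the convexity defect of the squared norm is exactly the penalty in
    [ln_solution_le]. *)
Lemma sqr_euclid_norm_conv (R : realType) (n : nat) (l : R)
    (x y : 'rV[R]_n) :
  sqr_euclid_norm (l *: x + (1 - l) *: y) =
  l * sqr_euclid_norm x + (1 - l) * sqr_euclid_norm y -
  l * (1 - l) * sqr_euclid_norm (x - y).
Proof.
rewrite /sqr_euclid_norm !mulr_sumr -big_split/= -sumrB; apply: eq_bigr => i _.
by rewrite !mxE; ring.
Qed.

Theorem corollary1p4 (R : realType) (n : nat) (T : R) (u : 'rV[R]_n -> R -> R)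
    (T_gt0 : 0 < T)
    (u_gt0 : forall (x : 'rV[R]_n) (t : R), 0 < t <= T -> 0 < u x t)
    (u_bounded : exists M : R,
      forall (x : 'rV[R]_n) (t : R), 0 < t <= T -> `|u x t| <= M)
    (u_heat : heat_solution T u) :
  forall t : R, 0 < t <= T ->
    convex_function [set: convex_lmodType 'rV[R]_n]
      (fun x : 'rV[R]_n => ln (u x t / heat_kernel x t)).
Proof.
move=> t tT l x y _ _.
(* The endpoints are trivial and are set apart because the minimum principle divides by [l] and
   [1 - l]. *)
have [->|l0] := eqVneq l 0%:i01; first by rewrite !conv0.
have [->|l1] := eqVneq l 1%:i01; first by rewrite !conv1.
have l01 : 0 < l%:num < 1 by rewrite !lt_neqAle eq_sym l0 l1 ge0 le1.
have [t0 _] := andP tT.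
have [M uM] := u_bounded.
have u_le z s : 0 < s <= T -> u z s <= M.
  by move=> sT; exact: le_trans (ler_norm _) (uM z s sT).
(* Dividing by the kernel adds to [ln u] a constant in z and the quadratic term that absorbs the
   penalty. *)
have lnE z : ln (u z t / heat_kernel z t) =
    ln (u z t) + ln ((4 * pi * t) `^ (n%:R / 2)) + sqr_euclid_norm z / (4 * t).
  have k0 : 0 < heat_kernel z t.
    by rewrite mulr_gt0 ?expR_gt0// invr_gt0 powR_gt0// !mulr_gt0// pi_gt0.
  rewrite lnM ?posrE ?invr_gt0 ?u_gt0// lnV ?posrE// ln_heat_kernel//.
  by rewrite opprB opprK addrA addrAC.
have := ln_solution_le x y u_gt0 u_le u_heat l01 tT.
rewrite convRE !lnE.
have -> : conv l x y =
    (l%:num *: (x : 'rV[R]_n) + (1 - l%:num) *: (y : 'rV[R]_n))%R by [].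
rewrite sqr_euclid_norm_conv /unstable.onem.
set N := sqr_euclid_norm (x - y).
have -> : l%:num * (1 - l%:num) / 4 * N / t =
  l%:num * (1 - l%:num) * N / (4 * t) by field; rewrite gt_eqF.
by lra.
Qed.
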